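(* Let $\mathbb{K}$ be a field, let $q\in\mathbb{K}^*$ be not a root of unity, let $(\alpha,\beta)\in\mathbb{K}^2\setminus\{(0,0)\}$, and let $A_{\alpha,\beta}=U_q^+(G_2)/\langle\Omega_1-\alpha,\Omega_2-\beta\rangle$, with $e_i$ the image of $E_i$. Then the set $$\mathcal{B}=\{e_1^ie_2^je_3^{\epsilon_1}e_4^{\epsilon_2}e_5^ke_6^l\mid i,j,k,l\in\mathbb{N},\ \epsilon_1,\epsilon_2\in\{0,1\}\}$$ is a $\mathbb{K}$-basis of $A_{\alpha,\beta}$.
   Context: $\mathbb{N}$ contains $0$. $A=U_q^+(G_2)$ is the $\mathbb{K}$-algebra generated by $E_1,\dots,E_6$ with defining relations \begin{align*} &E_2E_1=q^{-3}E_1E_2,\quad E_3E_1=q^{-1}E_1E_3-(q+q^{-1}+q^{-3})E_2,\quad E_3E_2=q^{-3}E_2E_3,\\ &E_4E_1=E_1E_4+(1-q^2)E_3^2,\quad E_4E_2=q^{-3}E_2E_4-\tfrac{q^4-2q^2+1}{q^4+q^2+1}E_3^3,\quad E_4E_3=q^{-3}E_3E_4,\\ &E_5E_1=qE_1E_5-(1+q^2)E_3,\quad E_5E_2=E_2E_5+(1-q^2)E_3^2,\\ &E_5E_3=q^{-1}E_3E_5-(q+q^{-1}+q^{-3})E_4,\quad E_5E_4=q^{-3}E_4E_5,\\ &E_6E_1=q^3E_1E_6-q^3E_5,\quad E_6E_2=q^3E_2E_6+(q^4+q^2-1)E_4+(q^2-q^4)E_3E_5,\\ &E_6E_3=E_3E_6+(1-q^2)E_5^2,\quad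 E_6E_4=q^{-3}E_4E_6-\tfrac{q^4-2q^2+1}{q^4+q^2+1}E_5^3,\quad E_6E_5=q^{-3}E_5E_6. \end{align*} It is a noetherian domain and the monomials $E_1^{k_1}\cdots E_6^{k_6}$ ($k_i\in\mathbb{N}$) form a $\mathbb{K}$-basis. Define the central elements \begin{align*} \Omega_1&=E_1E_3E_5+aE_1E_4+aE_2E_5+a'E_3^2,\\ \Omega_2&=E_2E_4E_6+bE_2E_5^3+bE_3^3E_6+b'E_3^2E_5^2+c'E_3E_4E_5+d'E_4^2, \end{align*} where $a=\frac{q^2+1+q^{-2}}{q^{-2}-1}$, $a'=\frac{q^6}{q^2-1}$, $b=-\frac{q^7-2q^5+q^3}{(q^4+q^2+1)(1-q^{-6})}$, $b'=\frac{q^{13}-q^{11}}{(q^4+q^2+1)^2}$, $c'=-\frac{q^9}{q^4+q^2+1}$, $d'=\frac{q^{12}}{q^6-1}$. $\langle\cdot\rangle$ denotes the two-sided ideal generated. *)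

(* Defs.v *)
From HB Require Import structures.
From mathcomp Require Import all_boot all_algebra.
From mathcomp Require Import boolp.
From mathcomp.multinomials Require Import monalg.

Set Implicit Arguments.
Unset Strict Implicit.
Unset Printing Implicit Defensive.

Import GRing.Theory.

Local Open Scope ring_scope.
Local Open Scope quotient_scope.

Section FreeAlgebra.

Variables (K : fieldType) (I : choiceType).

Definition free_alg : Type := {malg K[{fmonom I}]}.

HB.instance Definition _ := GRing.Lalgebra.on free_alg.

Fact free_alg_scalerAr (c : K) (x y : free_alg) : c *: (x * y) = x * (c *: y).
Proof.
have xC : (x : {malg K[{fmonom I}]}) * c%:MP = c *: (x : {malg K[{fmonom I}]}).
  rewrite malgM_def malgZ_def fgmulgU; apply: eq_bigr => /= k _.
  by rewrite mulm1 mulrC.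
rewrite scalerAl -[c *: x]xC -mulrA; congr (_ * _).
exact: (@mul_malgC _ _ c y).
Qed.

HB.instance Definition _ :=
  GRing.Lalgebra_isAlgebra.Build K free_alg free_alg_scalerAr.

Definition free_gen (i : I) : free_alg := << fmu i >>.

(* The augmentation, sending every generator to 0. It witnesses 1 != 0 in the *)
(* algebra Uq_G2 below, as algType requires.                                  *)
Definition free_aug (x : free_alg) : K :=
  @mcoeff {fmonom I} K (mone : {fmonom I}) x.

Fact free_aug_is_zmod_morphism : zmod_morphism free_aug.
Proof. by move=> x y; exact: mcoeffB. Qed.

Fact free_aug_is_monoid_morphism : monoid_morphism free_aug.
Proof.
split; first exact: mcoeffUU.
exact: (@mcoeff1g_is_multiplicative {fmonom I} K).1.
Qed.

HB.instance Definition _ :=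
  GRing.isZmodMorphism.Build free_alg K free_aug free_aug_is_zmod_morphism.
HB.instance Definition _ :=
  GRing.isMonoidMorphism.Build free_alg K free_aug free_aug_is_monoid_morphism.

Fact free_aug_is_scalable : scalable_for *%R free_aug.
Proof. by move=> c x; exact: mcoeffZ. Qed.

HB.instance Definition _ :=
  GRing.isScalable.Build K free_alg K *%R free_aug free_aug_is_scalable.

Lemma free_aug_gen i : free_aug (free_gen i) = 0.
Proof.
rewrite /free_aug mcoeffU1; case: eqP => // /(congr1 (@fdeg I)).
by rewrite fdegU fdeg1.
Qed.

End FreeAlgebra.

Section QuotientAlgebra.

Variables (K : fieldType) (A : algType K) (S : A -> Prop).

Definition in_ideal (x : A) : Prop :=
  exists (n : nat) (a s b : 'I_n -> A),
    (forall i, S (s i)) /\ x = \sum_i a i * s i * b i.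

Definition two_sided_ideal : A -> bool := fun x => `[< in_ideal x >].

Lemma in_idealP x : reflect (in_ideal x) (x \in two_sided_ideal).
Proof. exact: asboolP. Qed.

Lemma in_ideal0 : in_ideal 0.
Proof.
exists 0%N, (fun=> 0), (fun=> 0), (fun=> 0).
by split; [case | rewrite big_ord0].
Qed.

Lemma in_idealD x y : in_ideal x -> in_ideal y -> in_ideal (x + y).
Proof.
move=> [m [a [s [b [Ss ->]]]]] [n [a' [s' [b' [Ss' ->]]]]].
pose glue (f : 'I_m -> A) (g : 'I_n -> A) i :=
  match split i with inl j => f j | inr j => g j end.
exists (m + n)%N, (glue a a'), (glue s s'), (glue b b'); split.
  by move=> i; rewrite /glue; case: (split i).
rewrite big_split_ord /=; congr (_ + _); apply: eq_bigr => i _.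
  by rewrite /glue (unsplitK (inl i)).
by rewrite /glue (unsplitK (inr i)).
Qed.

Lemma in_idealM u v x : in_ideal x -> in_ideal (u * x * v).
Proof.
move=> [n [a [s [b [Ss ->]]]]].
exists n, (fun i => u * a i), s, (fun i => b i * v); split => //.
rewrite mulr_sumr mulr_suml; apply: eq_bigr => i _.
by rewrite !mulrA.
Qed.

Lemma in_idealMl u x : in_ideal x -> in_ideal (u * x).
Proof. by move=> /(in_idealM u 1); rewrite mulr1. Qed.

Lemma in_idealMr v x : in_ideal x -> in_ideal (x * v).
Proof. by move=> /(in_idealM 1 v); rewrite mul1r. Qed.

Lemma in_idealZ (c : K) x : in_ideal x -> in_ideal (c *: x).
Proof.
by move=> /(in_idealMl (c *: 1)); rewrite -scalerAl mul1r.
Qed.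

Lemma in_idealN x : in_ideal x -> in_ideal (- x).
Proof. by move=> /(in_idealMl (-1)); rewrite mulN1r. Qed.

Lemma in_ideal_gen x : S x -> in_ideal x.
Proof.
move=> Sx; exists 1%N, (fun=> 1), (fun=> x), (fun=> 1); split => //.
by rewrite big_ord1 mul1r mulr1.
Qed.

Fact two_sided_ideal_zmod_closed : zmod_closed two_sided_ideal.
Proof.
split=> [|x y /in_idealP Ix /in_idealP Iy]; apply/in_idealP.
  exact: in_ideal0.
exact: in_idealD Ix (in_idealN Iy).
Qed.

HB.instance Definition _ :=
  GRing.isZmodClosed.Build A two_sided_ideal two_sided_ideal_zmod_closed.

Definition ideal_pred : zmodClosed A :=
  GRing.ZmodClosed.clone A two_sided_ideal _.

(* The quotient may be the zero ring, so it only carries the pzRingType and   *)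
(* lmodType structures, and no algType one, in general.                       *)
Definition quot_alg : Type := Quotient.quot ideal_pred.

HB.instance Definition _ := GRing.Zmodule.on quot_alg.

Definition quot_pi (x : A) : quot_alg := \pi_(Quotient.quot ideal_pred) x.

Let rep (x : quot_alg) : A := repr (x : Quotient.quot ideal_pred).

Let repK x : quot_pi (rep x) = x. Proof. exact: reprK. Qed.

Lemma quot_pi_eq x y : quot_pi x = quot_pi y <-> in_ideal (x - y).
Proof.
split=> [/eqP | Ixy]; first by rewrite piE => /in_idealP.
by apply/eqP; rewrite piE; apply/in_idealP.
Qed.

Fact quot_pi_is_zmod_morphism : zmod_morphism quot_pi.
Proof. by move=> x y; rewrite /quot_pi raddfB. Qed.

HB.instance Definition _ :=
  GRing.isZmodMorphism.Build A quot_alg quot_pi quot_pi_is_zmod_morphism.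

Let qone : quot_alg := quot_pi 1.
Let qmul (x y : quot_alg) : quot_alg := quot_pi (rep x * rep y).
Let qscale (c : K) (x : quot_alg) : quot_alg := quot_pi (c *: rep x).

Let rep_pi x : in_ideal (rep (quot_pi x) - x).
Proof. by apply/quot_pi_eq; rewrite repK. Qed.

Let qmulE x y : qmul (quot_pi x) (quot_pi y) = quot_pi (x * y).
Proof.
apply/quot_pi_eq; set x' := rep _; set y' := rep _.
have -> : x' * y' - x * y = (x' - x) * y' + x * (y' - y).
  by rewrite mulrBl mulrBr addrA subrK.
apply: in_idealD; first exact/in_idealMr/rep_pi.
exact/in_idealMl/rep_pi.
Qed.

Let qscaleE c x : qscale c (quot_pi x) = quot_pi (c *: x).
Proof. by apply/quot_pi_eq; rewrite -scalerBr; exact/in_idealZ/rep_pi. Qed.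

Let qmulA : associative qmul.
Proof.
by move=> x y z; rewrite -[x]repK -[y]repK -[z]repK !qmulE mulrA.
Qed.

Let qmul1 : left_id qone qmul.
Proof. by move=> x; rewrite -[x]repK qmulE mul1r. Qed.

Let qmulr1 : right_id qone qmul.
Proof. by move=> x; rewrite -[x]repK qmulE mulr1. Qed.

Let qmulDl : left_distributive qmul +%R.
Proof.
move=> x y z; rewrite -[x]repK -[y]repK -[z]repK.
by rewrite -raddfD !qmulE -raddfD mulrDl.
Qed.

Let qmulDr : right_distributive qmul +%R.
Proof.
move=> x y z; rewrite -[x]repK -[y]repK -[z]repK.
by rewrite -raddfD !qmulE -raddfD mulrDr.
Qed.

HB.instance Definition _ := GRing.Zmodule_isPzRing.Build quot_alg
  qmulA qmul1 qmulr1 qmulDl qmulDr.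

Let qscaleA c d x : qscale c (qscale d x) = qscale (c * d) x.
Proof. by rewrite -[x]repK !qscaleE scalerA. Qed.

Let qscale1 : left_id 1 qscale.
Proof. by move=> x; rewrite -[x]repK qscaleE scale1r. Qed.

Let qscaleDr : right_distributive qscale +%R.
Proof.
move=> c x y; rewrite -[x]repK -[y]repK.
by rewrite -raddfD !qscaleE -raddfD scalerDr.
Qed.

Let qscaleDl x : {morph qscale^~ x : c d / c + d}.
Proof. by move=> c d; rewrite -[x]repK !qscaleE -raddfD scalerDl. Qed.

HB.instance Definition _ := GRing.Zmodule_isLmodule.Build K quot_alg
  qscaleA qscale1 qscaleDr qscaleDl.

Lemma quot_scalerAl (c : K) (x y : quot_alg) : c *: (x * y) = (c *: x) * y.
Proof.
rewrite -[x]repK -[y]repK; rewrite /GRing.mul /GRing.scale /=.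
by rewrite !(qmulE, qscaleE) scalerAl.
Qed.

Lemma quot_scalerAr (c : K) (x y : quot_alg) : c *: (x * y) = x * (c *: y).
Proof.
rewrite -[x]repK -[y]repK; rewrite /GRing.mul /GRing.scale /=.
by rewrite !(qmulE, qscaleE) scalerAr.
Qed.

Fact quot_pi_is_monoid_morphism : monoid_morphism quot_pi.
Proof. by split=> // x y; rewrite -qmulE. Qed.

HB.instance Definition _ :=
  GRing.isMonoidMorphism.Build A quot_alg quot_pi quot_pi_is_monoid_morphism.

Fact quot_pi_is_scalable : scalable quot_pi.
Proof. by move=> c x; rewrite -qscaleE. Qed.

HB.instance Definition _ :=
  GRing.isScalable.Build K A quot_alg *:%R quot_pi quot_pi_is_scalable.

End QuotientAlgebra.

Section G2.

Variables (K : fieldType) (q : K).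

(* Indices are shifted by one: E i, for i : 'I_6, stands for E_(i+1).         *)
Section Elements.

Variables (A : algType K) (E : 'I_6 -> A).

Local Notation E1 := (E (@Ordinal 6 0 isT)).
Local Notation E2 := (E (@Ordinal 6 1 isT)).
Local Notation E3 := (E (@Ordinal 6 2 isT)).
Local Notation E4 := (E (@Ordinal 6 3 isT)).
Local Notation E5 := (E (@Ordinal 6 4 isT)).
Local Notation E6 := (E (@Ordinal 6 5 isT)).

Let t : K := q + q^-1 + q ^- 3.
Let z : K := (q ^+ 4 - 2%:R * q ^+ 2 + 1) / (q ^+ 4 + q ^+ 2 + 1).

Definition G2_relations : seq A := [::
  E2 * E1 - q ^- 3 *: (E1 * E2);
  E3 * E1 - (q^-1 *: (E1 * E3) - t *: E2);
  E3 * E2 - q ^- 3 *: (E2 * E3);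
  E4 * E1 - (E1 * E4 + (1 - q ^+ 2) *: E3 ^+ 2);
  E4 * E2 - (q ^- 3 *: (E2 * E4) - z *: E3 ^+ 3);
  E4 * E3 - q ^- 3 *: (E3 * E4);
  E5 * E1 - (q *: (E1 * E5) - (1 + q ^+ 2) *: E3);
  E5 * E2 - (E2 * E5 + (1 - q ^+ 2) *: E3 ^+ 2);
  E5 * E3 - (q^-1 *: (E3 * E5) - t *: E4);
  E5 * E4 - q ^- 3 *: (E4 * E5);
  E6 * E1 - (q ^+ 3 *: (E1 * E6) - q ^+ 3 *: E5);
  E6 * E2 - (q ^+ 3 *: (E2 * E6) + (q ^+ 4 + q ^+ 2 - 1) *: E4
             + (q ^+ 2 - q ^+ 4) *: (E3 * E5));
  E6 * E3 - (E3 * E6 + (1 - q ^+ 2) *: E5 ^+ 2);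
  E6 * E4 - (q ^- 3 *: (E4 * E6) - z *: E5 ^+ 3);
  E6 * E5 - q ^- 3 *: (E5 * E6)].

Lemma G2_relations_vanish (f : {rmorphism A -> K}) :
  (forall c x, f x = 0 -> f (c *: x) = 0) -> (forall i, f (E i) = 0) ->
  all (fun x => f x == 0) G2_relations.
Proof.
move=> fZ fE.
have fB x y : f x = 0 -> f y = 0 -> f (x - y) = 0.
  by move=> x0 y0; rewrite rmorphB x0 y0 subr0.
have fD x y : f x = 0 -> f y = 0 -> f (x + y) = 0.
  by move=> x0 y0; rewrite rmorphD x0 y0 addr0.
have fM x y : f x = 0 -> f (x * y) = 0 by move=> x0; rewrite rmorphM x0 mul0r.
have fX n x : f x = 0 -> f (x ^+ n.+1) = 0.
  by move=> x0; rewrite rmorphXn x0 expr0n.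
rewrite /G2_relations /=; do !(apply/andP; split) => //; apply/eqP;
  by repeat first [exact: fE | apply: (fB _ _) | apply: (fD _ _)
                  | apply: (fZ _ _) | apply: (fX _ _) | apply: (fM _ _)].
Qed.

Let a : K := (q ^+ 2 + 1 + q ^- 2) / (q ^- 2 - 1).
Let a' : K := q ^+ 6 / (q ^+ 2 - 1).
Let b : K := - ((q ^+ 7 - 2%:R * q ^+ 5 + q ^+ 3)
                / ((q ^+ 4 + q ^+ 2 + 1) * (1 - q ^- 6))).
Let b' : K := (q ^+ 13 - q ^+ 11) / (q ^+ 4 + q ^+ 2 + 1) ^+ 2.
Let c' : K := - (q ^+ 9 / (q ^+ 4 + q ^+ 2 + 1)).
Let d' : K := q ^+ 12 / (q ^+ 6 - 1).

Definition Omega1 : A :=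
  E1 * E3 * E5 + a *: (E1 * E4) + a *: (E2 * E5) + a' *: E3 ^+ 2.

Definition Omega2 : A :=
  E2 * E4 * E6 + b *: (E2 * E5 ^+ 3) + b *: (E3 ^+ 3 * E6)
  + b' *: (E3 ^+ 2 * E5 ^+ 2) + c' *: (E3 * E4 * E5) + d' *: E4 ^+ 2.

End Elements.

Definition G2_rel (x : free_alg K 'I_6) : Prop :=
  x \in G2_relations (@free_gen K 'I_6).

Definition Uq_G2 : Type := quot_alg G2_rel.

HB.instance Definition _ := GRing.PzRing.on Uq_G2.
HB.instance Definition _ := GRing.Lmodule.on Uq_G2.

Fact Uq_G2_oner_neq0 : 1 != 0 :> Uq_G2.
Proof.
apply/eqP => e; have : quot_pi G2_rel 1 = quot_pi G2_rel 0.
  by rewrite rmorph1 raddf0.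
move=> /quot_pi_eq; rewrite subr0.
move=> [n [a [s [b [Gs /(congr1 (@free_aug K 'I_6))]]]]].
rewrite rmorph1 raddf_sum big1 => [/eqP|i _]; first by rewrite oner_eq0.
rewrite /= !rmorphM /=; suff /eqP -> : free_aug (s i) == 0.
  by rewrite mulr0 mul0r.
have augZ (c : K) (x : free_alg K 'I_6) :
    free_aug x = 0 -> free_aug (c *: x) = 0.
  by move=> x0; rewrite free_aug_is_scalable x0 mulr0.
have /allP := @G2_relations_vanish (free_alg K 'I_6) (@free_gen K 'I_6)
  (@free_aug K 'I_6) augZ (@free_aug_gen K 'I_6).
exact: (fun h => h _ (Gs i)).
Qed.

HB.instance Definition _ :=
  GRing.PzSemiRing_isNonZero.Build Uq_G2 Uq_G2_oner_neq0.
HB.instance Definition _ :=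
  GRing.Lmodule_isLalgebra.Build K Uq_G2 (@quot_scalerAl _ _ G2_rel).
HB.instance Definition _ :=
  GRing.Lalgebra_isAlgebra.Build K Uq_G2 (@quot_scalerAr _ _ G2_rel).

Definition Uq_E (i : 'I_6) : Uq_G2 := quot_pi G2_rel (free_gen K i).

Variables alpha beta : K.

Definition Omega_rel (x : Uq_G2) : Prop :=
  x \in [:: Omega1 Uq_E - alpha *: 1; Omega2 Uq_E - beta *: 1].

Definition A_alpha_beta : Type := quot_alg Omega_rel.

HB.instance Definition _ := GRing.PzRing.on A_alpha_beta.
HB.instance Definition _ := GRing.Lmodule.on A_alpha_beta.

Definition A_e (i : 'I_6) : A_alpha_beta := quot_pi Omega_rel (Uq_E i).

Definition monomial_B (m : nat * nat * bool * bool * nat * nat) :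
    A_alpha_beta :=
  let: (i, j, eps1, eps2, k, l) := m in
  A_e (@Ordinal 6 0 isT) ^+ i * A_e (@Ordinal 6 1 isT) ^+ j
  * A_e (@Ordinal 6 2 isT) ^+ eps1 * A_e (@Ordinal 6 3 isT) ^+ eps2
  * A_e (@Ordinal 6 4 isT) ^+ k * A_e (@Ordinal 6 5 isT) ^+ l.

End G2.

(* Bases are indexed families, so that repeated vectors are not allowed.      *)
Section Basis.

Variables (K : fieldType) (V : lmodType K) (I : eqType) (v : I -> V).

Definition linearly_independent : Prop :=
  forall (s : seq I) (c : I -> K),
    uniq s -> \sum_(i <- s) c i *: v i = 0 -> {in s, forall i, c i = 0}.

Definition spanning : Prop :=
  forall x : V, exists (s : seq I) (c : I -> K), x = \sum_(i <- s) c i *: v i.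

Definition is_basis : Prop := linearly_independent /\ spanning.

End Basis.

(* Main.v *)
(* The theorem is an instance of Bergman's diamond lemma. The generator Ei has
   the i-th positive root as its weight; compare words first by the height of
   their weight, then lexicographically. For this order the fifteen relations
   of U_q^+(G2) rewrite EjEi with i < j, while Omega1 = alpha and Omega2 = beta,
   solved for their quadratic terms, rewrite E3^2 and E4^2. The words containing
   no left-hand side are exactly the monomials of the statement. All overlaps
   are resolvable, hence every way of reducing a word yields the same normal
   form, and the coefficients of the normal form are functionals that vanish on
   the relations and separate the irreducible words. *)

From HB Require Import structures.
Require Import Defs.
From mathcomp Require Import all_boot all_algebra finmap ring.
From mathcomp.multinomials Require Import monalg.

Set Implicit Arguments.
Unset Strict Implicit.
Unset Printing Implicit Defensive.

Import GRing.Theory.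
Local Open Scope ring_scope.

(** * The diamond lemma for rewriting rules with quadratic left-hand sides *)

Section Rewriting.

Variables (I C : Type) (K : comPzRingType) (ev : C -> K).
Variable rule : I -> I -> option (seq (C * seq I)).

(** A function on words stands for the linear functional on the free algebra with these values;
    [combo] is its value at $uPv$. *)
Definition combo (F : seq I -> K) (P : seq (C * seq I)) (u v : seq I) : K :=
  \sum_(p <- P) ev p.1 * F (u ++ p.2 ++ v).

Definition respects (F : seq I -> K) (w : seq I) : Prop :=
  forall u x y v r, w = u ++ x :: y :: v -> rule x y = Some r ->
  F w = combo F r u v.

(* Rewrites the leftmost redex. *)
Fixpoint reduce (w : seq I) : option (seq (C * seq I)) :=
  if w is x :: ((y :: v) as w') then
    if rule x y is Some r then Some [seq (p.1, p.2 ++ v) | p <- r]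
    else omap (map (fun p => (p.1, x :: p.2))) (reduce w')
  else None.

Arguments reduce : simpl never.

Lemma reduce_cons2 x y v : reduce [:: x, y & v] =
  if rule x y is Some r then Some [seq (p.1, p.2 ++ v) | p <- r]
  else omap (map (fun p => (p.1, x :: p.2))) (reduce (y :: v)).
Proof. by []. Qed.

Lemma reduceP w P : reduce w = Some P ->
  exists u x y v r, [/\ w = u ++ x :: y :: v, rule x y = Some r
    & P = [seq (p.1, u ++ p.2 ++ v) | p <- r]].
Proof.
elim: w P => // x [|y v] // IH P; rewrite reduce_cons2.
case xy: (rule x y) => [r|]; first by move=> [<-]; exists [::], x, y, v, r.
case: (reduce _) IH => // Q /(_ _ erefl).
move=> [u [x' [y' [v' [r [-> x'y' ->]]]]]] [<-].
by exists (x :: u), x', y', v', r; split=> //; rewrite -map_comp.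
Qed.

Lemma reduce_Some u x y v r : rule x y = Some r ->
  exists P, reduce (u ++ x :: y :: v) = Some P.
Proof.
move=> xy; elim: u => [|a u [P wP]] /=.
  by rewrite reduce_cons2 xy; eexists.
case: u wP => [|b u] /= wP; rewrite reduce_cons2 wP; case: (rule a _) => [r'|];
  by eexists.
Qed.

Lemma reduce_None w :
  reduce w = None <-> sorted (fun x y => ~~ isSome (rule x y)) w.
Proof.
elim: w => // x [|y v] // IH; rewrite reduce_cons2 /=.
case: (rule x y) => //=; case: (reduce _) IH => [P|] [IH1 IH2]; split=> //.
by move/IH2.
Qed.

Lemma combo_reduce F w P u v : reduce w = Some P ->
  respects F (u ++ w ++ v) -> F (u ++ w ++ v) = combo F P u v.
Proof.
move=> /reduceP[u' [x [y [v' [r [-> xy ->]]]]]] /(_ (u ++ u') x y (v' ++ v) r).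
rewrite /combo big_map -!catA /= => /(_ erefl xy) ->.
by apply: eq_bigr => p _; rewrite -!catA.
Qed.

End Rewriting.

Arguments reduce : simpl never.

Section Diamond.

Variables (I C : eqType) (K : comPzRingType) (ev : C -> K).
Variable rule : I -> I -> option (seq (C * seq I)).

Local Notation combo := (combo ev).
Local Notation respects := (respects ev rule).
Local Notation reduce := (reduce rule).

Variable m : seq I -> nat.

(** The rank [m] takes the place of Bergman's well-founded order on words; the context [u], [v]
    expresses compatibility with multiplication. *)
Hypothesis m_rule : forall u x y v r (p : C * seq I),
  rule x y = Some r -> p \in r -> (m (u ++ p.2 ++ v) < m (u ++ x :: y :: v))%N.

Lemma m_reduce w P p u v : reduce w = Some P -> p \in P ->
  (m (u ++ p.2 ++ v) < m (u ++ w ++ v))%N.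
Proof.
move=> /reduceP[u' [x [y [v' [r [-> xy ->]]]]]] /mapP[p' p'r ->] /=.
by have := m_rule (u ++ u') (v' ++ v) xy p'r; rewrite -!catA.
Qed.

Section NormalForm.

Variable f : seq I -> K.

(** [f] prescribes the values on irreducible words. In [nf] the fuel starts above the rank, which
    every reduction lowers, so the default 0 is never reached. *)
Fixpoint nf_rec (n : nat) (w : seq I) : K :=
  if n is n'.+1 then
    if reduce w is Some P then \sum_(p <- P) ev p.1 * nf_rec n' p.2 else f w
  else 0.

Definition nf (w : seq I) : K := nf_rec (m w).+1 w.

Lemma nf_rec_fuel n n' w : (m w < n)%N -> (m w < n')%N ->
  nf_rec n w = nf_rec n' w.
Proof.
elim: n n' w => // n IH [//|n'] w; rewrite !ltnS => mn mn' /=.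
case wP: (reduce w) => [P|//]; apply: eq_big_seq => p pP.
have := m_reduce [::] [::] wP pP; rewrite /= !cats0 => mp.
by congr (_ * _); apply: IH; apply: leq_trans mp _.
Qed.

Lemma nf_reduce w P : reduce w = Some P -> nf w = combo nf P [::] [::].
Proof.
move=> wP; rewrite {1}/nf /= wP; apply: eq_big_seq => p pP.
have := m_reduce [::] [::] wP pP; rewrite /= !cats0 => mp.
by congr (_ * _); apply: (nf_rec_fuel mp).
Qed.

Lemma nf_irreducible w : reduce w = None -> nf w = f w.
Proof. by rewrite /nf /= => ->. Qed.

(* Bergman's relative form of confluence: only words below the overlap may be
   rewritten to join its two reductions. *)
Hypothesis overlap : forall x y z r1 r2,
  rule x y = Some r1 -> rule y z = Some r2 -> forall F u v,
  (forall w, (m w < m (u ++ [:: x; y; z] ++ v))%N -> respects F w) ->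
  combo F r1 u (z :: v) = combo F r2 (rcons u x) v.

(** The offset [d] between the redexes decides. Length 0: they coincide. Length 1: they share a
    letter and [overlap] applies. Longer: they are disjoint, and both sides expand to the same
    double sum. *)
Lemma two_redexes F u1 x1 y1 v1 r1 u2 x2 y2 v2 r2 :
  (forall w, (m w < m (u1 ++ x1 :: y1 :: v1))%N -> respects F w) ->
  u1 ++ x1 :: y1 :: v1 = u2 ++ x2 :: y2 :: v2 -> (size u1 <= size u2)%N ->
  rule x1 y1 = Some r1 -> rule x2 y2 = Some r2 ->
  combo F r1 u1 v1 = combo F r2 u2 v2.
Proof.
move=> IH eqw le12 xy1 xy2.
have [d eu2] : exists d, u2 = u1 ++ d.
  exists (drop (size u1) u2); rewrite -[LHS](cat_take_drop (size u1)).
  congr (_ ++ _); have /(congr1 (take (size u1))) := eqw.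
  by rewrite take_size_cat // takel_cat.
move: eqw; rewrite eu2 -catA => /eqP; rewrite eqseq_cat // eqxx /= => /eqP.
case: d eu2 => [|a [|b d]] eu2 /= [] ex ey ev1.
- by move: xy2; rewrite -ex -ey xy1 ev1 cats0 => -[<-].
- rewrite -ex cats1; rewrite -ey in xy2; rewrite ev1.
  apply: (overlap xy1 xy2) => w; rewrite /= -ev1; exact: IH.
rewrite -ex -ey in eu2 *.
(* Disjoint redexes: rewrite both, in either order. *)
have mid t : t \in r1 ->
    F (u1 ++ t.2 ++ v1) = combo F r2 (u1 ++ t.2 ++ d) v2.
  move=> tr; apply: (IH _ (m_rule _ _ xy1 tr)) xy2.
  by rewrite ev1 -!catA.
have mid' t : t \in r2 ->
    F ((u1 ++ [:: x1, y1 & d]) ++ t.2 ++ v2)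
    = combo F r1 u1 (d ++ t.2 ++ v2).
  move=> tr; apply: (IH _ _) xy1; last by rewrite -!catA.
  have := m_rule (u1 ++ [:: x1, y1 & d]) v2 xy2 tr.
  by rewrite -!catA /= ev1.
rewrite {1}/combo (eq_big_seq _ (fun t tr => congr1 _ (mid t tr))).
rewrite [RHS](eq_big_seq _ (fun t tr => congr1 _ (mid' t tr))).
under eq_bigr do rewrite mulr_sumr.
rewrite exchange_big /=; apply: eq_bigr => t2 _.
rewrite mulr_sumr; apply: eq_bigr => t1 _.
by rewrite mulrCA -!catA.
Qed.

(** [nf] follows one redex only; induction on the rank supplies the hypothesis under which
    [two_redexes] compares it with any other. *)
Lemma nf_respects w : respects nf w.
Proof.
have [n] := ubnP (m w); elim: n w => // n IH w mw u x y v r ew xy.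
have [P wP] := reduce_Some u v xy; rewrite -ew in wP.
rewrite (nf_reduce wP).
have [u' [x' [y' [v' [r' [ew' xy' ->]]]]]] := reduceP wP.
transitivity (combo nf r' u' v').
  by rewrite /combo big_map; apply: eq_bigr => p _; rewrite cats0.
have IHw w' : (m w' < m w)%N -> respects nf w'.
  by move=> lt; apply: IH; apply: leq_trans lt _.
(* [two_redexes] takes its redexes from left to right, and [reduceP] does not record that the chosen
   one is leftmost. *)
have [le|/ltnW le] := leqP (size u') (size u).
  by apply: two_redexes xy' xy => //; rewrite -ew' // ew.
by apply/esym; apply: two_redexes xy xy' => //; rewrite -ew // ew'.
Qed.

End NormalForm.
End Diamond.

(** * Resolving overlaps by computation *)

Section Reflection.

(* [(n, (e, i, j))] stands for [n q^e A^i B^j], see [coef_eval]; a rule may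
   list several terms with the same word, which add up. *)
Definition coef : Type := int * (int * nat * nat).

Variables (I : eqType) (rule : I -> I -> option (seq (coef * seq I))).

Definition coef_mul (c d : coef) : coef :=
  (c.1 * d.1, (c.2.1.1 + d.2.1.1, (c.2.1.2 + d.2.1.2)%N, (c.2.2 + d.2.2)%N)).

Fixpoint add_term (t : coef * seq I) (P : seq (coef * seq I)) :=
  if P is p :: P' then
    if (p.1.2 == t.1.2) && (p.2 == t.2) then
      let c := p.1.1 + t.1.1 in
      if c == 0 then P' else ((c, p.1.2), p.2) :: P'
    else p :: add_term t P'
  else [:: t].

Definition reduce_term (t : coef * seq I) : seq (coef * seq I) :=
  if reduce rule t.2 is Some P then [seq (coef_mul t.1 p.1, p.2) | p <- P]
  else [:: t].

Definition reduce_round (P : seq (coef * seq I)) : seq (coef * seq I) :=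
  foldr add_term [::] (flatten [seq reduce_term t | t <- P]).

Definition overlap_diff (x z : I) (r1 r2 : seq (coef * seq I)) :=
  [seq (p.1, rcons p.2 z) | p <- r1]
  ++ [seq ((- p.1.1, p.1.2), x :: p.2) | p <- r2].

(** The difference of the two reductions of $xyz$ must cancel within [n] rounds. Since $q$, $A$, $B$
    stay symbolic, one check serves every field and all [alpha], [beta]. *)
Definition resolves (n : nat) (x y z : I) : bool :=
  if (rule x y, rule y z) is (Some r1, Some r2) then
    nilp (iter n reduce_round (overlap_diff x z r1 r2))
  else true.

Variables (K : fieldType) (q A B : K).

Definition coef_eval (c : coef) : K :=
  c.1%:~R * (q ^ c.2.1.1 * A ^+ c.2.1.2 * B ^+ c.2.2).

Hypothesis q_neq0 : q != 0.

Local Notation ev := coef_eval.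

Lemma coef_evalM c d : ev (coef_mul c d) = ev c * ev d.
Proof. by rewrite /ev /= intrM expfzDr // !exprD; ring. Qed.

Lemma combo_cons (F : seq I -> K) t P u v :
  combo ev F (t :: P) u v = ev t.1 * F (u ++ t.2 ++ v) + combo ev F P u v.
Proof. by rewrite /combo big_cons. Qed.

Lemma combo_cat (F : seq I -> K) P Q u v :
  combo ev F (P ++ Q) u v = combo ev F P u v + combo ev F Q u v.
Proof. by rewrite /combo big_cat. Qed.

Lemma combo_add_term F t P u v :
  combo ev F (add_term t P) u v = combo ev F (t :: P) u v.
Proof.
elim: P => //= p P IH; case: ifP => [/andP[/eqP ek /eqP ew]|_].
  rewrite !combo_cons addrA -ew -mulrDl.
  have -> : ev t.1 + ev p.1 = ev (p.1.1 + t.1.1, t.1.2).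
    by rewrite /ev /= ek intrD; ring.
  case: eqP => [->|_]; last by rewrite combo_cons ek.
  by rewrite /ev /= mulr0z !mul0r add0r.
by rewrite !combo_cons IH combo_cons addrCA.
Qed.

Lemma mem_add_term t P p :
  p \in add_term t P -> p.2 \in [seq t.2 | t <- t :: P].
Proof.
elim: P => [|p' P IH] /=; first by rewrite !inE => /eqP->; rewrite eqxx.
case: ifP => _; first case: ifP => _.
- by move=> /(map_f snd) /= pP; rewrite !inE pP !orbT.
- rewrite !inE => /predU1P[->|/(map_f snd) /= ->]; by rewrite ?eqxx !orbT.
rewrite !inE => /predU1P[->|/IH]; first by rewrite eqxx orbT.
by rewrite !inE => /orP[->|->] //; rewrite !orbT.
Qed.

Lemma combo_collect (F : seq I -> K) P u v :
  combo ev F (foldr add_term [::] P) u v = combo ev F P u v.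
Proof. by elim: P => //= p P IH; rewrite combo_add_term !combo_cons IH. Qed.

Lemma mem_collect P p :
  p \in foldr add_term [::] P -> p.2 \in [seq t.2 | t <- P].
Proof.
elim: P p => //= t P IH p /mem_add_term; rewrite !inE => /orP[->//|].
by move=> /mapP[p' /IH p'P ->]; rewrite p'P orbT.
Qed.

Variable m : seq I -> nat.
Hypothesis m_rule : forall u x y v r (p : coef * seq I),
  rule x y = Some r -> p \in r -> (m (u ++ p.2 ++ v) < m (u ++ x :: y :: v))%N.

Lemma combo_reduce_round F P u v M :
  (forall w, (m w < M)%N -> respects ev rule F w) ->
  (forall w, w \in [seq p.2 | p <- P] -> (m (u ++ w ++ v) < M)%N) ->
  combo ev F (reduce_round P) u v = combo ev F P u v /\
  (forall w, w \in [seq p.2 | p <- reduce_round P] -> (m (u ++ w ++ v) < M)%N).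
Proof.
move=> FM PM; split.
  rewrite combo_collect; elim: P PM => //= t P IH PM.
  rewrite combo_cat combo_cons IH => [|w wP]; last first.
    by apply: PM; rewrite inE wP orbT.
  congr (_ + _); rewrite /reduce_term; case tP: reduce => [Q|]; last first.
    by rewrite combo_cons /combo big_nil addr0.
  have tM : respects ev rule F (u ++ t.2 ++ v).
    by apply/FM/PM; rewrite inE eqxx.
  rewrite (combo_reduce tP tM).
  rewrite /combo big_map mulr_sumr; apply: eq_bigr => p _ /=.
  by rewrite coef_evalM -mulrA.
move=> w /mapP[p /mem_collect/mapP[p' + ->] ->] => /flatten_mapP[t tP].
have tM : (m (u ++ t.2 ++ v) < M)%N by apply: PM; apply: map_f.
rewrite /reduce_term; case tQ: reduce => [Q|]; last by rewrite inE => /eqP->.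
move=> /mapP[p'' p''Q ->] /=; apply: ltn_trans tM.
exact: (m_reduce m_rule u v tQ p''Q).
Qed.

(** The first rewriting of $xyz$ already lands below the overlap and later rounds only descend, so
    [F] respects every step taken. The difference thus has the value of the empty combination. *)
Lemma resolvesP n x y z r1 r2 : resolves n x y z ->
  rule x y = Some r1 -> rule y z = Some r2 -> forall F u v,
  (forall w, (m w < m (u ++ [:: x; y; z] ++ v))%N -> respects ev rule F w) ->
  combo ev F r1 u (z :: v) = combo ev F r2 (rcons u x) v.
Proof.
rewrite /resolves => + xy yz; rewrite xy yz => /nilP check F u v FM.
have diff0 : combo ev F (overlap_diff x z r1 r2) u v = 0.
  have below w : w \in [seq p.2 | p <- overlap_diff x z r1 r2] ->
      (m (u ++ w ++ v) < m (u ++ [:: x; y; z] ++ v))%N.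
    rewrite map_cat mem_cat -!map_comp => /orP[] /mapP[p pr ->] /=.
      by rewrite cat_rcons; exact: (m_rule u (z :: v) xy pr).
    by have := m_rule (rcons u x) v yz pr; rewrite !cat_rcons.
  suff [] : combo ev F (iter n reduce_round (overlap_diff x z r1 r2)) u v
      = combo ev F (overlap_diff x z r1 r2) u v /\
      (forall w, w \in [seq p.2 | p <- iter n reduce_round
         (overlap_diff x z r1 r2)] ->
         (m (u ++ w ++ v) < m (u ++ [:: x; y; z] ++ v))%N).
    by rewrite check {1}/combo big_nil => <-.
  elim: n {check} => [//|n [IH IHb]] /=.
  by have [-> ?] := combo_reduce_round FM IHb.
apply/eqP; rewrite -subr_eq0 -diff0 combo_cat {1 3}/combo big_map /=; apply/eqP.
congr (_ + _); first by apply: eq_bigr => p _; rewrite cat_rcons.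
rewrite /combo big_map -sumrN; apply: eq_bigr => p _ /=.
by rewrite cat_rcons /ev /= mulrNz !mulNr.
Qed.

End Reflection.

(** * The rewriting rules of the quotient of U_q^+(G2) *)

Local Notation l1 := (@Ordinal 6 0 isT).
Local Notation l2 := (@Ordinal 6 1 isT).
Local Notation l3 := (@Ordinal 6 2 isT).
Local Notation l4 := (@Ordinal 6 3 isT).
Local Notation l5 := (@Ordinal 6 4 isT).
Local Notation l6 := (@Ordinal 6 5 isT).

Section G2Rewriting.

Definition qterm (c e : int) (w : seq 'I_6) : coef * seq 'I_6 :=
  ((c, (e, 0%N, 0%N)), w).
Arguments qterm (c e)%_Z w.

(* Letters stand for the rescaled generators [G2_scale i *: E i] below, for
   which all coefficients are Laurent polynomials in q. The symbols A and B of
   [coef_eval] stand for alpha / a' and (q^4 + q^2 + 1)^2 beta / d', the constant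
   terms of the rules for E3^2 and E4^2. *)
Definition G2_rhs (x y : 'I_6) : seq (coef * seq 'I_6) :=
  match val x, val y with
  | 1, 0 => [:: qterm 1 (-3) [:: l1; l2]]
  | 2, 0 => [:: qterm 1 (-1) [:: l1; l3]; qterm (-1) (-3) [:: l2]]
  | 2, 1 => [:: qterm 1 (-3) [:: l2; l3]]
  | 2, 2 => [:: (1%Z, (0%Z, 1%N, 0%N), [::]);
                qterm 1 (-6) [:: l1; l3; l5]; qterm (-1) (-4) [:: l1; l3; l5];
                qterm 1 (-6) [:: l1; l4]; qterm 1 (-6) [:: l2; l5]]
  | 3, 0 => [:: qterm 1 0 [:: l1; l4];
                qterm 1 0 [:: l3; l3]; qterm (-1) 6 [:: l3; l3]]
  | 3, 1 => [:: qterm 1 (-3) [:: l2; l4];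
                qterm (-1) 8 [:: l3; l3; l3]; qterm 1 6 [:: l3; l3; l3];
                qterm 1 2 [:: l3; l3; l3]; qterm (-1) 0 [:: l3; l3; l3]]
  | 3, 2 => [:: qterm 1 (-3) [:: l3; l4]]
  | 3, 3 => [:: (1%Z, (0%Z, 0%N, 1%N), [::]);
                qterm 1 (-12) [:: l2; l4; l6]; qterm (-1) (-6) [:: l2; l4; l6];
                qterm 1 1 [:: l2; l5; l5; l5];
                qterm (-2) (-1) [:: l2; l5; l5; l5];
                qterm 1 (-3) [:: l2; l5; l5; l5];
                qterm 1 5 [:: l3; l3; l3; l6]; qterm (-1) 3 [:: l3; l3; l3; l6];
                qterm (-1) (-1) [:: l3; l3; l3; l6];
                qterm 1 (-3) [:: l3; l3; l3; l6];
                qterm (-1) 7 [:: l3; l3; l5; l5]; qterm 1 5 [:: l3; l3; l5; l5];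
                qterm 1 1 [:: l3; l3; l5; l5];
                qterm (-1) (-1) [:: l3; l3; l5; l5];
                qterm 1 3 [:: l3; l4; l5]; qterm (-1) (-3) [:: l3; l4; l5]]
  | 4, 0 => [:: qterm 1 1 [:: l1; l5]; qterm (-1) 0 [:: l3];
                qterm (-1) 2 [:: l3]]
  | 4, 1 => [:: qterm 1 0 [:: l2; l5];
                qterm 1 0 [:: l3; l3]; qterm (-1) 6 [:: l3; l3]]
  | 4, 2 => [:: qterm 1 (-1) [:: l3; l5]; qterm (-1) (-3) [:: l4]]
  | 4, 3 => [:: qterm 1 (-3) [:: l4; l5]]
  | 5, 0 => [:: qterm 1 3 [:: l1; l6]; qterm (-1) 3 [:: l5]]
  | 5, 1 => [:: qterm 1 3 [:: l2; l6];
                qterm 1 4 [:: l4]; qterm 1 2 [:: l4]; qterm (-1) 0 [:: l4];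
                qterm 1 2 [:: l3; l5]; qterm (-1) 8 [:: l3; l5]]
  | 5, 2 => [:: qterm 1 0 [:: l3; l6];
                qterm 1 0 [:: l5; l5]; qterm (-1) 2 [:: l5; l5]]
  | 5, 3 => [:: qterm 1 (-3) [:: l4; l6];
                qterm (-1) 4 [:: l5; l5; l5]; qterm 2 2 [:: l5; l5; l5];
                qterm (-1) 0 [:: l5; l5; l5]]
  | 5, 4 => [:: qterm 1 (-3) [:: l5; l6]]
  | _, _ => [::]
  end%N.

(** The values 2 and 3 are the letters of $E_3$ and $E_4$, whose squares are rewritten by the
    relations for $\Omega_1$ and $\Omega_2$. *)
Definition G2_redex (x y : 'I_6) : bool :=
  (y < x)%N || (x == y) && (val x \in [:: 2; 3]).

Definition G2_rule (x y : 'I_6) : option (seq (coef * seq 'I_6)) :=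
  if G2_redex x y then Some (G2_rhs x y) else None.

(** The list gives the heights of the positive roots $a, 3a+b, 2a+b, 3a+2b, a+b, b$, with $a$ the
    short simple root. *)
Definition height (w : seq 'I_6) : nat :=
  sumn [seq nth 0%N [:: 1; 4; 3; 5; 2; 1] (val x) | x <- w].

(** Once the letters are written out, statements over ['I_6] are closed and [vm_compute] can decide
    them. *)
Lemma forall_I6 (P : pred 'I_6) : [&& P l1, P l2, P l3, P l4, P l5 & P l6] ->
  forall x, P x.
Proof.
move=> /and5P[? ? ? ? /andP[? ?]] [[|[|[|[|[|[|//]]]]]] lt];
  by rewrite (bool_irrelevance lt isT).
Qed.

(** Only 32 of the 216 triples are overlaps: the chains $x \ge y \ge z$ with equality allowed at
    $E_3$ and $E_4$ alone. Twenty rounds suffice for each. *)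
Lemma G2_resolves x y z : resolves G2_rule 20 x y z.
Proof.
by move: z; apply: forall_I6; move: y; apply: forall_I6; move: x;
   apply: forall_I6; vm_compute.
Qed.

Fixpoint lex_rank (n : nat) (w : seq 'I_6) : nat :=
  match n, w with
  | n'.+1, x :: w' => (x.+1 * 7 ^ n' + lex_rank n' w')%N
  | _, _ => 0%N
  end.

Lemma lex_rank_ltn n w : (lex_rank n w < 7 ^ n)%N.
Proof.
elim: n w => [|n IH] [|x w] //=; first by rewrite expn_gt0.
apply: leq_trans (_ : (x.+2 * 7 ^ n <= _)%N).
  by rewrite (mulSnr x.+1) ltn_add2l.
by rewrite expnS leq_mul2r ltnS ltn_ord orbT.
Qed.

Lemma lex_rank_lex n (u v w : seq 'I_6) (x y : 'I_6) :
  (size u < n)%N -> (x < y)%N ->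
  (lex_rank n (u ++ x :: v) < lex_rank n (u ++ y :: w))%N.
Proof.
move=> + xy; elim: u n => [|a u IH] [|n] //= un; last by rewrite ltn_add2l IH.
apply: leq_trans (leq_addr _ _).
apply: leq_trans (_ : (x.+2 * 7 ^ n <= _)%N); last first.
  by rewrite leq_mul2r ltnS xy orbT.
by rewrite (mulSnr x.+1) ltn_add2l lex_rank_ltn.
Qed.

(* A word has at most [height w] letters, so its base-7 digits, read from the
   left and padded with zeros, order words of equal height lexicographically;
   the leading term lets the height dominate. *)
Definition word_rank (w : seq 'I_6) : nat :=
  (7 ^ height w + lex_rank (height w) w)%N.

Lemma height_cat u v : height (u ++ v) = (height u + height v)%N.
Proof. by rewrite /height map_cat sumn_cat. Qed.

Lemma size_height w : (size w <= height w)%N.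
Proof.
elim: w => // x w IH; rewrite -cat1s height_cat size_cat leq_add //.
by move: x {IH}; apply: forall_I6.
Qed.

(** At equal height the lexicographic comparison is settled by the first letter of the redex,
    whatever follows it. *)
Lemma G2_rhs_decreases x y : all (fun p : coef * seq 'I_6 =>
  (height p.2 < height [:: x; y])%N || (height p.2 == height [:: x; y])
    && (if p.2 is a :: _ then a < x else false)%N) (G2_rhs x y).
Proof. by move: y; apply: forall_I6; move: x; apply: forall_I6; vm_compute. Qed.

(** If the height drops to $h$, the new rank is below $2\cdot 7^h \le 7^{h+1}$, which the old
    leading term bounds. At equal height, [lex_rank_lex] compares the base-7 parts. *)
Lemma word_rank_rule (u : seq 'I_6) x y v r (p : coef * seq 'I_6) :
  G2_rule x y = Some r -> p \in r ->
  (word_rank (u ++ p.2 ++ v) < word_rank (u ++ x :: y :: v))%N.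
Proof.
rewrite /G2_rule; case: ifP => // _ [<-] /(allP (G2_rhs_decreases x y)).
rewrite -[x :: y :: v]/([:: x; y] ++ v) => /orP[lt|/andP[/eqP eqh]].
  apply: leq_trans (leq_addr _ _).
  apply: leq_trans (_ : (7 ^ (height (u ++ p.2 ++ v)).+1 <= _)%N); last first.
    by rewrite leq_exp2l // !height_cat ltn_add2l ltn_add2r.
  rewrite /word_rank expnS -addnS.
  apply: leq_trans (leq_add (leqnn _) (lex_rank_ltn _ _)) _.
  by rewrite addnn -mul2n leq_mul2r orbT.
rewrite /word_rank !height_cat eqh ltn_add2l; case: p.2 => // a w ax.
apply: lex_rank_lex ax.
rewrite addnA; apply: leq_trans (leq_addr _ _).
rewrite -addn1 leq_add ?size_height //.
exact: leq_trans (size_height [:: x; y]).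
Qed.

End G2Rewriting.

(** * The defining relations as scalar multiples of the rewriting rules *)

Section G2Relations.

Variables (K : fieldType) (q : K).
Hypothesis q_neq0 : q != 0.
Hypothesis q_nonroot : forall n : nat, (0 < n)%N -> q ^+ n != 1.
Variables alpha beta : K.

Let D : K := q ^+ 4 + q ^+ 2 + 1.
Let A0 : K := alpha * (q ^+ 2 - 1) / q ^+ 6.
Let B0 : K := D ^+ 2 * beta * (q ^+ 6 - 1) / q ^+ 12.

Definition G2_eval : coef -> K := coef_eval q A0 B0.

Local Notation ev := G2_eval.

(** Scaling $E_2$ and $E_4$ absorbs the factor $q+q^{-1}+q^{-3}=q^{-3}D$ and clears the denominators
    $D$. *)
Definition G2_scale (i : 'I_6) : K := if val i \in [:: 1; 3]%N then D else 1.

Lemma q2B1_neq0 : q ^+ 2 - 1 != 0.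
Proof. by rewrite subr_eq0 q_nonroot. Qed.

Lemma q6B1_neq0 : q ^+ 6 - 1 != 0.
Proof. by rewrite subr_eq0 q_nonroot. Qed.

Lemma D_neq0 : D != 0.
Proof.
have e : q ^+ 6 - 1 = (q ^+ 2 - 1) * D by rewrite /D; ring.
by have := q6B1_neq0; rewrite e mulf_eq0 => /norP[].
Qed.

Lemma G2_scale_neq0 i : G2_scale i != 0.
Proof. by rewrite /G2_scale; case: ifP => _; rewrite ?D_neq0 ?oner_neq0. Qed.

Section Algebra.

Variables (A : algType K) (E : 'I_6 -> A).

Definition word_prod (w : seq 'I_6) : A := \prod_(i <- w) (G2_scale i *: E i).

Definition G2_rule_defect (x y : 'I_6) : A :=
  word_prod [:: x; y] - \sum_(p <- G2_rhs x y) ev p.1 *: word_prod p.2.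

Definition all_relations : seq A :=
  G2_relations q E
  ++ [:: Omega1 q E - alpha *: 1; Omega2 q E - beta *: 1].

(** In the order of [all_relations]: the redex of each relation and the factor turning the rule into
    it. The factor undoes the scaling; for the squares it also restores the leading coefficients
    $a'$ and $d'$. *)
Definition relation_table : seq (K * ('I_6 * 'I_6)) :=
  [seq ((G2_scale t.1 * G2_scale t.2)^-1, t) | t <-
    [:: (l2, l1); (l3, l1); (l3, l2); (l4, l1); (l4, l2); (l4, l3);
        (l5, l1); (l5, l2); (l5, l3); (l5, l4);
        (l6, l1); (l6, l2); (l6, l3); (l6, l4); (l6, l5)]]
  ++ [:: (q ^+ 6 / (q ^+ 2 - 1), (l3, l3));
         (q ^+ 12 / (q ^+ 6 - 1) / D ^+ 2, (l4, l4))].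

Lemma merge_scale (V : lmodType K) (a b : K) (v w : V) :
  a *: v + (b *: v + w) = (a + b) *: v + w.
Proof. by rewrite addrA -scalerDl. Qed.

Lemma all_relationsE : all_relations =
  [seq t.1 *: G2_rule_defect t.2.1 t.2.2 | t <- relation_table].
Proof.
have qn0 := q_neq0; have q2n0 := q2B1_neq0; have q6n0 := q6B1_neq0.
have Dn0 := D_neq0; rewrite /D in Dn0.
(* The condition $1-q^2 \ne 0$ in a form suited to the side conditions of [field]. *)
have q2n0' : 1 + -1 * q ^+ 2 != 0 by rewrite mulN1r subr_eq0 eq_sym q_nonroot.
rewrite /all_relations /G2_relations /Omega1 /Omega2 /relation_table.
rewrite /G2_rule_defect /G2_rhs /word_prod /= unlock /=.
rewrite /G2_eval /coef_eval /G2_scale /= ?(inE, eqxx) /=.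
move: (E l1) (E l2) (E l3) (E l4) (E l5) (E l6) => e1 e2 e3 e4 e5 e6.
do ![congr (_ :: _)].
all: rewrite -?scalerAl -?scalerAr ?mulr1 -?mulrA ?scalerA.
all: rewrite ?merge_scale ?addr0 ?scalerBr ?scalerDr ?opprD ?opprK ?scalerA.
all: rewrite -?scaleNr ?addrA.
(* In the Omega relations, bring the rewritten square and the constant first. *)
16: rewrite [LHS](ACl (4*5*1*2*3))%AC.
17: rewrite [LHS](ACl (6*7*1*2*3*4*5))%AC.
all: do ?congr (_ + _).
all: first [ congr (_ *: _)
  | rewrite -[LHS]scaleN1r; congr (_ *: _)
  | rewrite -[LHS]scale1r; congr (_ *: _)].
all: rewrite /exprz /A0 /B0 /D /=.
all: try field.
all: rewrite ?qn0 ?Dn0 ?q2n0 ?q6n0 ?q2n0' ?oner_neq0 //=.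
Qed.

End Algebra.

Lemma relation_table_neq0 t : t \in relation_table -> t.1 != 0.
Proof.
rewrite mem_cat => /orP[/mapP[s _ ->] | ] /=.
  by rewrite invr_eq0 mulf_neq0 ?G2_scale_neq0.
by rewrite !inE => /orP[]/eqP-> /=;
  rewrite !(mulf_neq0, invr_eq0, expf_neq0, q_neq0, q2B1_neq0, q6B1_neq0,
            D_neq0).
Qed.

Lemma relation_table_redex x y :
  ((x, y) \in [seq t.2 | t <- relation_table]) = G2_redex x y.
Proof.
(* Projecting away the scalars of [K] leaves a closed computation on letters. *)
rewrite /relation_table map_cat -map_comp /=; apply/eqP.
by move: y; apply: forall_I6; move: x; apply: forall_I6; vm_compute.
Qed.

(** As the scalar is nonzero, the defect vanishes in the quotient along with the relation. *)
Lemma G2_rule_defectE (A : algType K) (E : 'I_6 -> A) x y r :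
  G2_rule x y = Some r ->
  exists2 c, c != 0 & exists2 s, s \in all_relations E
    & s = c *: G2_rule_defect E x y.
Proof.
rewrite /G2_rule -relation_table_redex; case: ifP => // /mapP[t tT exy] _.
exists t.1; first exact: relation_table_neq0.
exists (t.1 *: G2_rule_defect E x y) => //.
by rewrite all_relationsE; apply/mapP; exists t => //; rewrite -exy.
Qed.

Lemma all_relationsP (A : algType K) (E : 'I_6 -> A) s :
  s \in all_relations E ->
  exists c x y, G2_rule x y = Some (G2_rhs x y)
    /\ s = c *: G2_rule_defect E x y.
Proof.
rewrite all_relationsE => /mapP[t tT ->]; exists t.1, t.2.1, t.2.2; split=> //.
by rewrite /G2_rule -relation_table_redex -surjective_pairing map_f.
Qed.

End G2Relations.

(** * Spanning families and the free algebra *)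

Section Spanning.

Variables (K : fieldType) (V : lmodType K) (I : eqType) (v : I -> V).

(** Repeated indices are allowed, so that combinations add by concatenation; [in_span_spanning]
    merges them. *)
Definition in_span (x : V) : Prop :=
  exists ps : seq (K * I), x = \sum_(p <- ps) p.1 *: v p.2.

Lemma in_span_sum (T : eqType) (r : seq T) (c : T -> K) (F : T -> V) :
  (forall t, t \in r -> in_span (F t)) -> in_span (\sum_(t <- r) c t *: F t).
Proof.
elim: r => [|t r IH] rF; first by exists [::]; rewrite !big_nil.
have [|ps eps] := IH; first by move=> t' t'r; apply: rF; rewrite inE t'r orbT.
have [|qs eqs] := rF t; first by rewrite inE eqxx.
exists ([seq (c t * p.1, p.2) | p <- qs] ++ ps).
rewrite big_cons big_cat -eps eqs big_map scaler_sumr; congr (_ + _).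
by apply: eq_bigr => p _; rewrite scalerA.
Qed.

Lemma in_span_gen i : in_span (v i).
Proof. by exists [:: (1, i)]; rewrite big_seq1 scale1r. Qed.

Lemma in_spanZ c x : in_span x -> in_span (c *: x).
Proof.
move=> xs.
have := @in_span_sum unit [:: tt] (fun=> c) (fun=> x) (fun _ _ => xs).
by rewrite big_seq1.
Qed.

Lemma in_span_spanning : (forall x, in_span x) -> spanning v.
Proof.
move=> vs x; have [ps ->] := vs x.
exists (undup (unzip2 ps)), (fun i => \sum_(p <- ps | p.2 == i) p.1).
under [RHS]eq_bigr do rewrite scaler_suml.
rewrite (exchange_big_dep xpredT) //=; apply: eq_big_seq => p pP.
rewrite -big_filter (_ : [seq i <- _ | p.2 == i] = [:: p.2]) ?big_seq1 //.
rewrite (eq_filter (fun i => eq_sym _ _)) filter_pred1_uniq ?undup_uniq //.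
by rewrite mem_undup map_f.
Qed.

End Spanning.

Section FreeAlgebra.

Variables (K : fieldType) (I : choiceType) (scale : I -> K).
Hypothesis scale_neq0 : forall i, scale i != 0.

Definition free_word (w : seq I) : free_alg K I :=
  \prod_(i <- w) (scale i *: free_gen K i).

Lemma free_wordE w :
  free_word w = << \prod_(i <- w) scale i *g FMonom w >>
    :> {malg K[{fmonom I}]}.
Proof.
elim: w => [|i w IH]; first by rewrite /free_word !big_nil -fmoneE.
rewrite /free_word !big_cons -/(free_word w) IH /free_gen.
have -> : scale i *: (<< fmu i >> : {malg K[{fmonom I}]})
    = << scale i *g fmu i >>.
  by apply/malgP => k; rewrite mcoeffZ !mcoeffU mulrnAr mulr1.
have mulUU := fgmulUU (scale i) (\prod_(j <- w) scale j) (fmu i) (FMonom w).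
apply: etrans (_ : _ = fgmul _ _) (etrans mulUU _); first exact: malgM_def.
by congr << _ *g _ >>; apply: val_inj; rewrite /= fmM fmU.
Qed.

Lemma prod_scale_neq0 w : \prod_(i <- w) scale i != 0.
Proof. by rewrite prodf_seq_neq0; apply/allP => i _; apply/implyP. Qed.

Lemma free_word_span x : in_span free_word x.
Proof.
rewrite [x](@monalgE {fmonom I} K x).
exists [seq (mcoeff k x / \prod_(i <- k : seq I) scale i, k : seq I) |
  k <- enum_fset (msupp x)].
rewrite big_map; apply: eq_bigr => k _ /=; rewrite free_wordE fmK.
apply/malgP => k'; rewrite mcoeffZ !mcoeffU.
by rewrite mulrnAr divfK ?prod_scale_neq0.
Qed.

(** Up to the nonzero product of scales, the words are the monomial basis of the free algebra, so
    values on them may be prescribed. *)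
Lemma free_word_functional (f : seq I -> K) :
  exists L : {scalar free_alg K I}, forall w, L (free_word w) = f w.
Proof.
pose h (k : {fmonom I}) := f k / \prod_(i <- k : seq I) scale i.
pose L0 : free_alg K I -> K := @mmap {fmonom I} K K idfun h.
have L0B : zmod_morphism L0 by exact: (@mmap_is_additive _ _ _ idfun h).
have L0Z : scalable_for *%R L0.
  move=> c x; rewrite /L0 (mmapEw (msuppZ_le c (x : {malg K[{fmonom I}]}))).
  rewrite mulr_sumr; apply: eq_bigr => k _; by rewrite mcoeffZ /= -mulrA.
pose L : {scalar free_alg K I} := HB.pack L0
  (GRing.isZmodMorphism.Build _ _ L0 L0B)
  (GRing.isScalable.Build _ _ _ _ L0 L0Z).
exists L => w; rewrite /L /= /L0 free_wordE mmapU /h mulrC divfK //.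
exact: prod_scale_neq0.
Qed.

End FreeAlgebra.

(** * The quotient map from the free algebra *)

Lemma Omega_map (K : fieldType) (q : K) (A B : algType K) (E : 'I_6 -> A)
    (f : A -> B) :
  {morph f : x y / x + y} -> {morph f : x y / x * y} -> scalable f ->
  f (Omega1 q E) = Omega1 q (f \o E) /\ f (Omega2 q E) = Omega2 q (f \o E).
Proof.
move=> fD fM fZ; have fX n x : f (x ^+ n.+1) = f x ^+ n.+1.
  by elim: n => // n IH; rewrite exprS fM IH -exprS.
by split; rewrite /Omega1 /Omega2 !fD !fZ !(fM, fX) /=.
Qed.

Section Quotient.

Variables (K : fieldType) (q alpha beta : K).

Local Notation F := (free_alg K 'I_6).
Local Notation U := (Uq_G2 q).
Local Notation Q := (A_alpha_beta q alpha beta).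
Local Notation rels := (all_relations q alpha beta (@free_gen K 'I_6)).

Definition Uq_pi (x : F) : U := quot_pi (G2_rel q) x.

Definition Q_pi (u : U) : Q := quot_pi (Omega_rel (q:=q) alpha beta) u.

Definition free_pi (x : F) : Q := Q_pi (Uq_pi x).

Lemma quot_pi_surj (A : algType K) (S : A -> Prop) (y : quot_alg S) :
  exists x, quot_pi S x = y.
Proof. by exists (repr (y : Quotient.quot (ideal_pred S))); apply: reprK. Qed.

Lemma Uq_pi_surj u : exists x, Uq_pi x = u.
Proof. exact: quot_pi_surj. Qed.

Lemma free_pi_surj y : exists x, free_pi x = y.
Proof.
have [u <-] := quot_pi_surj y; have [x <-] := Uq_pi_surj u.
by exists x.
Qed.

Lemma Uq_piB : {morph Uq_pi : x y / x - y}.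
Proof. by move=> x y; rewrite /Uq_pi raddfB. Qed.

Lemma Uq_piD : {morph Uq_pi : x y / x + y}.
Proof. by move=> x y; rewrite /Uq_pi raddfD. Qed.

Lemma Uq_piM : {morph Uq_pi : x y / x * y}.
Proof. by move=> x y; rewrite /Uq_pi rmorphM. Qed.

Lemma Uq_piZ : scalable Uq_pi.
Proof. by move=> c x; rewrite /Uq_pi linearZ. Qed.

Lemma free_piB x y : free_pi (x - y) = free_pi x - free_pi y.
Proof. by rewrite /free_pi Uq_piB /Q_pi raddfB. Qed.

Lemma free_piZ c x : free_pi (c *: x) = c *: free_pi x.
Proof. by rewrite /free_pi Uq_piZ /Q_pi linearZ. Qed.

HB.instance Definition _ :=
  GRing.isZmodMorphism.Build F Q free_pi free_piB.

HB.instance Definition _ :=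
  GRing.isScalable.Build K F Q *:%R free_pi free_piZ.

Lemma free_piM x y : free_pi (x * y) = free_pi x * free_pi y.
Proof. by rewrite /free_pi Uq_piM /Q_pi rmorphM. Qed.

Lemma free_pi1 : free_pi 1 = 1.
Proof. by []. Qed.

Local Notation O1 := (Omega1 q (@free_gen K 'I_6) - alpha *: 1).
Local Notation O2 := (Omega2 q (@free_gen K 'I_6) - beta *: 1).

Lemma Uq_pi_Omega :
  Uq_pi O1 = Omega1 q (Uq_E q) - alpha *: 1 /\
  Uq_pi O2 = Omega2 q (Uq_E q) - beta *: 1.
Proof.
have [e1 e2] := @Omega_map K q F U (@free_gen K 'I_6) _ Uq_piD Uq_piM Uq_piZ.
split; first by rewrite (Uq_piB (Omega1 q _)) e1 Uq_piZ.
by rewrite (Uq_piB (Omega2 q _)) e2 Uq_piZ.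
Qed.

Lemma Omega_rel_lift u : Omega_rel alpha beta u ->
  exists2 s, s \in rels & Uq_pi s = u.
Proof.
have [e1 e2] := Uq_pi_Omega.
rewrite /Omega_rel in_cons mem_seq1 => /orP[/eqP->|/eqP->].
  exists O1; last exact: e1.
  by rewrite /all_relations mem_cat; apply/orP; right; apply: mem_head.
exists O2; last exact: e2.
rewrite /all_relations mem_cat; apply/orP; right.
by rewrite in_cons; apply/orP; right; apply: mem_head.
Qed.

Lemma free_pi_rels s : s \in rels -> free_pi s = 0.
Proof.
have [e1 e2] := Uq_pi_Omega.
have pi0 : Q_pi 0 = 0 by rewrite /Q_pi raddf0.
have ker (T : algType K) (S : T -> Prop) x : S x -> quot_pi S x = 0.
  move=> Sx; rewrite -[RHS](raddf0 (quot_pi S)); apply/quot_pi_eq.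
  by rewrite subr0; apply: in_ideal_gen.
rewrite /all_relations mem_cat => /orP[sG|].
  by rewrite /free_pi (_ : Uq_pi s = 0) //; apply: ker.
rewrite in_cons mem_seq1 => /orP[/eqP->|/eqP->].
  rewrite /free_pi e1; apply: ker; exact: mem_head.
rewrite /free_pi e2; apply: ker.
by rewrite /Omega_rel in_cons; apply/orP; right; apply: mem_head.
Qed.

(** Each summand lifts factor by factor, its middle factor to one of the two $\Omega$ entries of
    [rels]. *)
Lemma Uq_ideal_lift u : in_ideal (Omega_rel (q:=q) alpha beta) u ->
  exists2 x, in_ideal (fun s => s \in rels) x & Uq_pi x = u.
Proof.
have pi0 : Uq_pi 0 = 0 by rewrite /Uq_pi raddf0.
move=> [n [a [s [b [Ss ->]]]]].
elim/big_rec: _ => [|i u' _ [x' x'I <-]].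
  by exists 0; [exact: in_ideal0 | exact: pi0].
have [a' <-] := Uq_pi_surj (a i); have [b' <-] := Uq_pi_surj (b i).
have [s' s'R <-] := Omega_rel_lift (Ss i).
exists (a' * s' * b' + x'); last by rewrite Uq_piD 2!Uq_piM.
by apply: in_idealD => //; apply: in_idealM; apply: in_ideal_gen.
Qed.

(** The image of [x] in [U] lies in the $\Omega$ ideal and lifts to some [y] in the full ideal; then
    [x - y] dies in [U], hence lies in the ideal of the fifteen relations. *)
Lemma free_pi_ker x : free_pi x = 0 -> in_ideal (fun s => s \in rels) x.
Proof.
have pi0 : Q_pi 0 = 0 by rewrite /Q_pi raddf0.
rewrite -pi0 => /quot_pi_eq; rewrite subr0 => /Uq_ideal_lift[y yI /esym].
move=> /quot_pi_eq [n [a [s [b [Ss xy]]]]].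
rewrite -[x](subrK y) xy; apply: in_idealD => //.
exists n, a, s, b; split=> // i; rewrite /all_relations mem_cat.
by apply/orP; left; apply: Ss.
Qed.

End Quotient.

(** * Irreducible words and the basis *)

Section IrreducibleWords.

Definition G2_normal (x y : 'I_6) : bool := ~~ G2_redex x y.

Definition monomial_word (m : nat * nat * bool * bool * nat * nat) :
    seq 'I_6 :=
  let: (i, j, eps1, eps2, k, l) := m in
  nseq i l1 ++ nseq j l2 ++ nseq eps1 l3 ++ nseq eps2 l4 ++ nseq k l5
  ++ nseq l l6.

Definition word_monomial (w : seq 'I_6) : nat * nat * bool * bool * nat * nat :=
  (count_mem l1 w, count_mem l2 w, 0 < count_mem l3 w, 0 < count_mem l4 w,
   count_mem l5 w, count_mem l6 w)%N.

Lemma monomial_wordK : cancel monomial_word word_monomial.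
Proof.
move=> [[[[[i j] e1] e2] k] l]; rewrite /word_monomial /monomial_word.
rewrite !count_cat !count_nseq /= !(mul0n, mul1n, addn0, add0n).
by case: e1 e2 => [] [].
Qed.

(** Turns the condition on adjacent letters into one on all pairs, which passes to subwords obtained
    by filtering. *)
Lemma G2_normal_trans : transitive G2_normal.
Proof.
have trans y x z : G2_normal x y ==> G2_normal y z ==> G2_normal x z.
  by move: z; apply: forall_I6; move: x; apply: forall_I6; move: y;
     apply: forall_I6; vm_compute.
by move=> y x z xy yz; have := trans y x z; rewrite xy yz.
Qed.

Lemma reduce_G2_None w : reduce G2_rule w = None <-> pairwise G2_normal w.
Proof.
rewrite -(sorted_pairwise G2_normal_trans) reduce_None.
rewrite (@eq_sorted _ _ G2_normal) // => x y.
by rewrite /G2_rule /G2_normal; case: ifP.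
Qed.

Lemma monomial_word_irreducible m : reduce G2_rule (monomial_word m) = None.
Proof.
apply/reduce_G2_None; have nseq_normal n x : G2_normal x x ->
    pairwise G2_normal (nseq n x).
  by move=> xx; elim: n => //= n ->; rewrite all_nseq xx orbT.
move: m => [[[[[i j] e1] e2] k] l]; rewrite /monomial_word !pairwise_cat.
have bseq_normal (b : bool) x : pairwise G2_normal (nseq b x) by case: b.
have cross n x p y : G2_normal x y ->
    allrel G2_normal (nseq n x) (nseq p y).
  by move=> xy; rewrite /allrel all_nseq [X in _ || X]all_nseq xy !orbT.
by rewrite !bseq_normal !nseq_normal // !allrel_catr !cross.
Qed.

Lemma irreducible_monomial_word w :
  reduce G2_rule w = None -> monomial_word (word_monomial w) = w.
Proof.
move=> wN; have wP : pairwise G2_normal w by apply/reduce_G2_None.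
have sub : subrel G2_normal (fun x y : 'I_6 => x <= y)%N.
  by move=> x y; rewrite /G2_normal /G2_redex negb_or -leqNgt => /andP[].
have sorted_leq s : reduce G2_rule s = None ->
    sorted (fun x y : 'I_6 => x <= y)%N s.
  by move/reduce_G2_None/(pairwise_sorted)/(sub_sorted sub).
(* Two occurrences of $E_3$ or of $E_4$ would form a pair that is not normal, even if not
   adjacent. *)
have small x : x \in [:: l3; l4] ->
    (0 < count_mem x w)%N = count_mem x w :> nat.
  move=> xw; have := pairwise_filter (pred1 x) wP.
  have /all_pred1P -> := filter_all (pred1 x) w.
  rewrite size_filter; case: (count_mem x w) => [|[|n]] //= /andP[/andP[]].
  by move: xw; rewrite !inE => /orP[]/eqP->.
(* Both words are sorted, so equal letter counts make them equal. *)
apply: (sorted_eq (leT := fun x y : 'I_6 => x <= y)%N).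
- by move=> y x z; apply: leq_trans.
- by move=> x y xy; apply/val_inj/anti_leq.
- exact/sorted_leq/monomial_word_irreducible.
- exact: sorted_leq.
have [s3 s4] := (small l3 isT, small l4 isT).
apply/allP => x _ /=; move: x; apply: forall_I6.
rewrite /monomial_word /word_monomial !count_cat !count_nseq /=.
by rewrite !(mul0n, mul1n, addn0, add0n) s3 s4 !eqxx.
Qed.

End IrreducibleWords.

(** * Spanning by reduction, independence by normal-form functionals *)

Section MonomialBasis.

Variables (K : fieldType) (q : K).
Hypothesis q_neq0 : q != 0.
Hypothesis q_nonroot : forall n : nat, (0 < n)%N -> q ^+ n != 1.
Variables alpha beta : K.

Local Notation ev := (G2_eval q alpha beta).
Local Notation word := (word_prod q (@free_gen K 'I_6)).
Local Notation scale w := (\prod_(i <- w) G2_scale q i).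
Local Notation rels := (all_relations q alpha beta (@free_gen K 'I_6)).
Local Notation defect :=
  (G2_rule_defect q alpha beta (@free_gen K 'I_6)).
Local Notation pi := (free_pi q alpha beta).

Lemma word_prodE (A : algType K) (E : 'I_6 -> A) w :
  word_prod q E w = scale w *: \prod_(i <- w) E i.
Proof.
elim: w => [|i w IH]; first by rewrite /word_prod !big_nil scale1r.
rewrite /word_prod !big_cons -/(word_prod q E w) IH.
by rewrite -scalerAl -scalerAr scalerA.
Qed.

Lemma word_prod_cat (A : algType K) (E : 'I_6 -> A) u v :
  word_prod q E (u ++ v) = word_prod q E u * word_prod q E v.
Proof. by rewrite /word_prod big_cat. Qed.

Lemma defect_context (A : algType K) (E : 'I_6 -> A) u v x y :
  word_prod q E u * G2_rule_defect q alpha beta E x y * word_prod q E v =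
  word_prod q E (u ++ x :: y :: v)
  - \sum_(p <- G2_rhs x y) ev p.1 *: word_prod q E (u ++ p.2 ++ v).
Proof.
rewrite /G2_rule_defect mulrBr mulrBl; congr (_ - _).
  by rewrite -word_prod_cat -word_prod_cat -catA.
rewrite mulr_sumr mulr_suml; apply: eq_bigr => p _.
by rewrite -scalerAr -scalerAl word_prod_cat word_prod_cat mulrA.
Qed.

Lemma prod_monomial_word (R : pzSemiRingType) (e : 'I_6 -> R) i j e1 e2 k l :
  \prod_(x <- monomial_word (i, j, e1, e2, k, l)) e x =
  e l1 ^+ i * e l2 ^+ j * e l3 ^+ e1 * e l4 ^+ e2 * e l5 ^+ k * e l6 ^+ l.
Proof.
have prod_nseq n x : \prod_(y <- nseq n x) e y = e x ^+ n.
  by rewrite big_nseq -Monoid.iteropE.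
by rewrite /monomial_word !big_cat /= !prod_nseq !mulrA.
Qed.

Lemma free_pi_monomial m :
  pi (word (monomial_word m))
  = scale (monomial_word m) *: monomial_B q alpha beta m.
Proof.
rewrite word_prodE linearZ /=; congr (_ *: _).
have -> w : pi (\prod_(i <- w) free_gen K i) = \prod_(i <- w) pi (free_gen K i).
  elim: w => [|i w IH]; first by rewrite !big_nil free_pi1.
  by rewrite !big_cons free_piM IH.
by move: m => [[[[[i j] e1] e2] k] l]; rewrite prod_monomial_word.
Qed.

Lemma scale_neq0 w : scale w != 0.
Proof. exact/prod_scale_neq0/G2_scale_neq0. Qed.

(** Induction on the rank: an irreducible word is a scaled basis monomial, and a reducible one
    equals a combination of lower words because defects vanish in the quotient. *)
Lemma monomial_B_spanning : spanning (monomial_B q alpha beta).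
Proof.
apply: in_span_spanning => y; have [x <-] := free_pi_surj y.
have [ps ->] := free_word_span (G2_scale_neq0 q_nonroot) x.
rewrite raddf_sum /=; under eq_bigr do rewrite linearZ /=.
apply: (in_span_sum fst (F := fun p => pi (word p.2))) => p _.
have [n] := ubnP (word_rank p.2); elim: n (p.2) => // n IH w wn.
case wP : (reduce G2_rule w) => [P|]; last first.
  rewrite -(irreducible_monomial_word wP) free_pi_monomial.
  exact/in_spanZ/in_span_gen.
have [u [a [b [v [r [ew ab eP]]]]]] := reduceP wP.
have eqw : pi (word w) = \sum_(t <- P) ev t.1 *: pi (word t.2).
  have [c c0 [s sR es]] := G2_rule_defectE q_neq0 q_nonroot alpha beta
    (@free_gen K 'I_6) ab.
  have d0 : pi (defect a b) = 0.
    have /eqP := free_pi_rels sR.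
    by rewrite es linearZ /= scaler_eq0 (negPf c0) => /eqP.
  have : pi (word u * defect a b * word v) = 0.
    rewrite (free_piM _ _ _ (word u * _)) (free_piM _ _ _ (word u)).
    by rewrite d0 mulr0 mul0r.
  rewrite defect_context -ew free_piB raddf_sum => /eqP.
  rewrite subr_eq0 => /eqP -> /=; rewrite eP big_map.
  have -> : r = G2_rhs a b by move: ab; rewrite /G2_rule; case: ifP => // _ [].
  by apply: eq_bigr => p' _; rewrite linearZ.
rewrite eqw; apply: (in_span_sum (fun t => ev t.1)
  (F := fun t => pi (word t.2))) => t tP.
have := m_reduce word_rank_rule [::] [::] wP tP; rewrite /= !cats0 => lt.
by apply: IH; apply: leq_trans lt _.
Qed.

Lemma scalar_sandwich_eq0 (A : algType K) (L : {scalar A}) (I : eqType)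
    (g : I -> A) (d : A) :
  (forall i j, L (g i * d * g j) = 0) ->
  forall a b, in_span g a -> in_span g b -> L (a * d * b) = 0.
Proof.
move=> L0 _ _ [ps ->] [qs ->].
rewrite mulr_suml mulr_suml raddf_sum big1 // => p _.
rewrite mulr_sumr raddf_sum big1 // => p' _.
by rewrite -scalerAr -!scalerAl scalerA [LHS]linearZ /= L0 mulr0.
Qed.

Lemma G2_overlap x y z r1 r2 :
  G2_rule x y = Some r1 -> G2_rule y z = Some r2 -> forall F u v,
  (forall w, (word_rank w < word_rank (u ++ [:: x; y; z] ++ v))%N ->
     respects ev G2_rule F w) ->
  combo ev F r1 u (z :: v) = combo ev F r2 (rcons u x) v.
Proof.
move=> xy yz F u v.
exact: (resolvesP q_neq0 word_rank_rule (G2_resolves x y z) xy yz).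
Qed.

(** Between two words this is [nf_respects] for the rule at [x], [y]; bilinearity in [a] and [b]
    extends it to the whole free algebra. *)
Lemma defect_functional (f : seq 'I_6 -> K) (L : {scalar free_alg K 'I_6}) :
  let N := nf ev G2_rule word_rank f in
  (forall w, L (word w) = N w) ->
  forall a b x y, G2_rule x y = Some (G2_rhs x y) ->
  L (a * defect x y * b) = 0.
Proof.
move=> N LN a b x y xy.
have Lword u v : L (word u * defect x y * word v) = 0.
  rewrite defect_context raddfB raddf_sum /= LN.
  under eq_bigr do rewrite linearZ /= LN.
  apply/eqP; rewrite subr_eq0; apply/eqP.
  exact: (nf_respects word_rank_rule f G2_overlap erefl xy).
by apply: (scalar_sandwich_eq0 Lword); apply: free_word_span;
  apply: G2_scale_neq0.
Qed.

Lemma monomial_B_independent : linearly_independent (monomial_B q alpha beta).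
Proof.
move=> s c s_uniq sum0 j js.
(* The functional dual to the monomial [j]: 1 on its word and 0 on all other irreducible words. *)
pose N := nf ev G2_rule word_rank (fun w => (w == monomial_word j)%:R).
have [L LN] := free_word_functional (G2_scale_neq0 q_nonroot) N.
(* A lift of the vanishing combination; the division offsets the scaling of letters. *)
pose x := \sum_(i <- s)
  (c i / scale (monomial_word i)) *: word (monomial_word i).
have Lx0 : L x = 0.
  have : pi x = 0.
    rewrite -sum0 raddf_sum; apply: eq_bigr => i _ /=.
    by rewrite free_piZ free_pi_monomial scalerA divfK ?scale_neq0.
  move/free_pi_ker => [n [a [t [b [tR ->]]]]].
  rewrite raddf_sum big1 // => i _ /=.
  have [d [u [v [uv ->]]]] := all_relationsP q_neq0 q_nonroot (tR i).
  rewrite -scalerAr -scalerAl linearZ /=.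
  by rewrite (defect_functional LN) ?mulr0.
move: Lx0; rewrite raddf_sum /=.
(* Only the summand of index [j] survives, so [L x] is [c j] divided by a nonzero scale. *)
rewrite (bigD1_seq j) //= [X in _ + X]big1 => [|i ij]; last first.
  rewrite [L _]linearZ /= LN /N nf_irreducible ?monomial_word_irreducible //.
  by rewrite (can_eq monomial_wordK) (negPf ij) mulr0.
rewrite addr0 [L _]linearZ /= LN /N nf_irreducible;
  last exact: monomial_word_irreducible.
rewrite eqxx mulr1 => /eqP.
by rewrite mulf_eq0 invr_eq0 (negPf (scale_neq0 _)) orbF => /eqP.
Qed.

End MonomialBasis.

Theorem proposition4p4 (K : fieldType) (q : K) (q_neq0 : q != 0)
    (q_not_root_of_unity : forall n : nat, (0 < n)%N -> q ^+ n != 1)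
    (alpha beta : K) (alpha_beta_neq0 : (alpha, beta) != (0, 0)) :
  is_basis (monomial_B q alpha beta).
Proof.
split; first exact: monomial_B_independent.
exact: monomial_B_spanning.
Qed.
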